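(* Let $A$ be any set of permutations and, for an integer $L$, let $A_{\le L}$ denote the set of permutations in $A$ of length at most $L$ (and similarly for other sets). Then for all positive integers $N\ge n$ and $m$, \[ A_{\le n}\subseteq \mathrm{Av}(\mathsf{BiSC}(A_{\le N},m))_{\le n}. \] Furthermore, if $A=\mathrm{Av}(L)$ for a finite list $L$ of mesh patterns (classical or not) whose longest pattern has length $k$, and if $N\ge n\ge k$ and $m\ge k$, then \[ A_{\le n}= \mathrm{Av}(\mathsf{BiSC}(A_{\le N},m))_{\le n}. \]
   Context: For a word $w$ of distinct integers, $\mathrm{fl}(w)$ replaces the $i$-th smallest letter by $i$. A mesh pattern is a pair $(p,R)$ with $p$ a permutation of length $k$ and $R\subseteq\{0,\dots,k\}\times\{0,\dots,k\}$; a classical pattern $p$ is identified with $(p,\emptyset)$. An occurrence of $(p,R)$ in a permutation $\pi$ of length $n$ is a sequence $1\le j_1<\dots<j_k\le n$ with $\mathrm{fl}(\pi_{j_1}\cdots\pi_{j_k})=p$ such that, with $j_0=0$, $j_{k+1}=n+1$ and $v_0<\dots<v_{k+1}$ being $0$, the sorted values $\pi_{j_i}$, and $n+1$, for each $(a,b)\in R$ no index $x$ satisfies $j_a<x<j_{a+1}$ and $v_b<\pi_x<v_{b+1}$. $\pi$ contains $(p,R)$ if an occurrence exists; $\mathrm{Av}(M)$ is the set of permutations avoiding all mesh patterns in $M$. The maximal shading of an occurrence of $p$ in $\pi$ is the set of all boxes $(a,b)$ with no such point $x$. $\mathsf{Mine}(B,m)$, for a finite set $B$ of permutations: for each classical pattern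 $p$ of length at most $m$ output $(p,\mathrm{sh}_p)$, where $\mathrm{sh}_p$ is the set of inclusion-maximal elements among the maximal shadings of all occurrences of $p$ in permutations of $B$ (empty if $p$ occurs in none). $\mathsf{Forb}(S)$: for each $(p,\mathrm{sh}_p)\in S$ (processed in order of increasing length of $p$), let $\mathrm{forb}_p$ be the set of inclusion-minimal subsets $R\subseteq\{0,\dots,k\}^2$ that are not contained in any member of $\mathrm{sh}_p$; then remove from $\mathrm{forb}_p$ every $R$ that is a consequence of some shading in $\mathrm{forb}_q$ for a classical pattern $q$ properly contained in $p$ processed earlier, meaning that there is $R'\in\mathrm{forb}_q$ such that every permutation containing $(p,R)$ also contains $(q,R')$. The output is the set of mesh patterns $(p,R)$ with $R\in\mathrm{forb}_p$. $\mathsf{BiSC}(B,m)=\mathsf{Forb}(\mathsf{Mine}(B,m))$. *)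

(* Defs.v *)
From mathcomp Require Import all_boot perm.
From mathcomp Require Import boolp classical_sets.

Set Implicit Arguments.
Unset Strict Implicit.
Unset Printing Implicit Defensive.

Local Open Scope classical_set_scope.

(* Permutations of arbitrary length, the empty permutation included. *)
Definition permutation : Type := {n : nat & 'S_n}.

Definition len (pi : permutation) : nat := tag pi.

(* 'I_n is 0-based; letters and positions are shifted to be 1-based, so that 0
   and n + 1 are available as the border values of a frame. *)
Definition position (n : nat) (x : 'I_n) : nat := x.+1.

Definition letter (pi : permutation) (x : 'I_(len pi)) : nat :=
  position (tagged pi x).

Definition subword (pi : permutation) (s : seq 'I_(len pi)) : seq nat :=
  [seq letter x | x <- s].

Definition word (pi : permutation) : seq nat :=
  subword (enum 'I_(len pi)).

Definition fl (w : seq nat) : seq nat :=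
  [seq (index x (sort leq w)).+1 | x <- w].

Definition classical_occurrence (p pi : permutation)
    (j : (len p).-tuple 'I_(len pi)) : bool :=
  sorted ltn [seq position x | x <- j] && (fl (subword j) == word p).

Definition frame (n : nat) (s : seq nat) : seq nat := 0 :: rcons s n.+1.

Notation shading k := {set 'I_k.+1 * 'I_k.+1}.

Definition in_box (p pi : permutation) (j : (len p).-tuple 'I_(len pi))
    (ab : 'I_(len p).+1 * 'I_(len p).+1) (x : 'I_(len pi)) : bool :=
  let js := frame (len pi) [seq position y | y <- j] in
  let vs := frame (len pi) (sort leq (subword j)) in
  let: (a, b) := ab in
  (nth 0 js a < position x < nth 0 js a.+1)
  && (nth 0 vs b < letter x < nth 0 vs b.+1).

Definition empty_box (p pi : permutation) (j : (len p).-tuple 'I_(len pi))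
    (ab : 'I_(len p).+1 * 'I_(len p).+1) : bool :=
  [forall x, ~~ in_box j ab x].

Definition maximal_shading (p pi : permutation)
    (j : (len p).-tuple 'I_(len pi)) : shading (len p) :=
  finset (empty_box j).

Definition mesh_pattern : Type := {p : permutation & shading (len p)}.

Definition classical (p : permutation) : mesh_pattern :=
  existT (fun p : permutation => shading (len p)) p finset.set0.

Definition mesh_len (P : mesh_pattern) : nat := len (tag P).

Definition occurrence (P : mesh_pattern) (pi : permutation)
    (j : (mesh_len P).-tuple 'I_(len pi)) : bool :=
  classical_occurrence j && [forall ab in tagged P, empty_box j ab].

Definition contains (pi : permutation) (P : mesh_pattern) : Prop :=
  exists j : (mesh_len P).-tuple 'I_(len pi), occurrence j.

Definition Av (M : set mesh_pattern) : set permutation :=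
  [set pi | forall P, M P -> ~ contains pi P].

Definition upto (n : nat) (A : set permutation) : set permutation :=
  [set pi | A pi /\ len pi <= n].

(* Shadings of a fixed pattern p live in a finite type, so sh_p is a finite set
   even though B is an arbitrary set of permutations. *)
Definition shadings_in (B : set permutation) (p : permutation) :
    {set shading (len p)} :=
  finset (fun R => `[< exists2 pi, B pi &
    exists2 j : (len p).-tuple 'I_(len pi),
      classical_occurrence j & R = maximal_shading j >]).

Definition sh (B : set permutation) (p : permutation) : {set shading (len p)} :=
  finset (maxset (fun R => R \in shadings_in B p)).

Definition mined : Type := {p : permutation & {set shading (len p)}}.

Definition mined_pattern (p : permutation) (shp : {set shading (len p)}) :
    mined :=
  existT (fun p : permutation => {set shading (len p)}) p shp.

Definition Mine (B : set permutation) (m : nat) : set mined :=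
  [set mined_pattern (sh B p) | p in [set p | len p <= m]].

Definition minimal_forbidden (k : nat) (shp : {set shading k}) :
    {set shading k} :=
  finset (minset (fun R : shading k => ~~ [exists S in shp, R \subset S])).

Definition properly_contained (q p : permutation) : Prop :=
  q <> p /\ contains p (classical q).

Definition consequence (P Q : mesh_pattern) : Prop :=
  forall pi, contains pi P -> contains pi Q.

(* The mesh patterns (p, R) with R in the final (pruned) forb_p, for the p of
   length less than l. *)
Fixpoint forb (S : set mined) (l : nat) : set mesh_pattern :=
  if l is l'.+1 then
    forb S l' `|`
    [set P | [/\ mesh_len P = l',
       exists2 shp : {set shading (mesh_len P)},
         S (mined_pattern shp) & tagged P \in minimal_forbidden shp
     & ~ exists Q, [/\ forb S l' Q, properly_contained (tag Q) (tag P)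
                     & consequence P Q]]]
  else set0.

Definition Forb (S : set mined) : set mesh_pattern := \bigcup_l forb S l.

Definition BiSC (B : set permutation) (m : nat) : set mesh_pattern :=
  Forb (Mine B m).

(* Main.v *)
(** A mesh pattern (p, R) with |p| <= m occurs in no permutation of B exactly
    when R lies below no member of sh_p: the maximal shading of an occurrence
    records all the meshes R that it realises. So the patterns that BiSC outputs
    are avoided by B. Conversely, a pattern (p, R) avoided by B shrinks to a
    minimal forbidden (p, R'), which is either output or pruned because it
    entails a pattern already output; either way a permutation avoiding the
    output avoids (p, R). *)

Require Import Defs.
From mathcomp Require Import all_boot perm.
From mathcomp Require Import boolp classical_sets.

Local Open Scope classical_set_scope.

Lemma occurrenceE (P : mesh_pattern) (pi : permutation)
    (j : (mesh_len P).-tuple 'I_(len pi)) :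
  occurrence j = classical_occurrence j && (tagged P \subset maximal_shading j).
Proof.
rewrite /occurrence; congr andb.
by apply/forall_inP/fintype.subsetP => h ab /h; rewrite inE.
Qed.

(** Shadings of a fixed pattern form a finite type, so the maximal shading of any occurrence extends
    to a maximal element of [shadings_in]; conversely, each member of [sh] is realised by an
    occurrence in [B]. *)
Lemma sh_covers (B : set permutation) (P : mesh_pattern) :
  [exists S in sh B (tag P), tagged P \subset S]
  <-> exists2 pi, B pi & contains pi P.
Proof.
split=> [/exists_inP [S]|[pi Bpi [j]]].
  rewrite inE => /maxsetp; rewrite inE => /asboolP [pi Bpi [j occj ->]] subR.
  by exists pi => //; exists j; rewrite occurrenceE occj subR.
rewrite occurrenceE => /andP [occj subR].
have : maximal_shading j \in shadings_in B (tag P).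
  by rewrite inE; apply/asboolP; exists pi => //; exists j.
move=> /(@maxset_exists _ (fun R => R \in shadings_in B (tag P))).
case=> S maxS subS.
by apply/exists_inP; exists S; [rewrite inE | apply: fintype.subset_trans subS].
Qed.

(** Going through projections turns an equation of dependent pairs into one of shading sets, without
    a cast. *)
Lemma Mine_tagged (B : set permutation) (m : nat) (M : mined) :
  Mine B m M -> tagged M = sh B (tag M).
Proof. by case=> p _ <-. Qed.

Lemma forb_minimal (S : set mined) (l : nat) (P : mesh_pattern) :
  forb S l P ->
  exists2 shp : {set shading (len (tag P))},
    S (mined_pattern shp) & tagged P \in minimal_forbidden shp.
Proof. by elim: l => [//|l IHl] /= [/IHl //|[]]. Qed.

Lemma BiSC_not_contained (B : set permutation) (m : nat) (P : mesh_pattern)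
    (pi : permutation) :
  BiSC B m P -> B pi -> ~ contains pi P.
Proof.
case=> l _ /forb_minimal [shp /Mine_tagged /= ->].
rewrite inE => /minsetp /negP uncovered Bpi piP.
by apply/uncovered/sh_covers; exists pi.
Qed.

Lemma BiSC_entailed (B : set permutation) (m : nat) (P : mesh_pattern) :
  mesh_len P <= m -> (forall pi, B pi -> ~ contains pi P) ->
  exists2 Q, BiSC B m Q & consequence P Q.
Proof.
case: P => p R lepm avoidP.
have : ~~ [exists S in sh B p, R \subset S].
  apply/negP => /(sh_covers B (existT _ p R)) [pi Bpi piP].
  exact: avoidP piP.
move=> /(@minset_exists _
  (fun R : shading (len p) => ~~ [exists S in sh B p, R \subset S])).
case=> R' minR' subR'.
pose P' : mesh_pattern := existT (fun p => shading (len p)) p R'.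
have PP' : consequence (existT _ p R) P'.
  move=> pi [j]; rewrite occurrenceE => /andP [occj subR].
  by exists j; rewrite occurrenceE occj /=; apply: fintype.subset_trans subR.
(* Pruning tests against an earlier level of [forb], itself part of the output, so a pruned [P']
   entails an output pattern without induction. *)
have [[Q [forbQ _ P'Q]]|unpruned] := pselect (exists Q,
    [/\ forb (Mine B m) (len p) Q, properly_contained (tag Q) (tag P')
      & consequence P' Q]).
  by exists Q; [exists (len p) | move=> pi /PP' /P'Q].
(* Level [l.+1] of [forb] adds the patterns of length exactly [l]. *)
exists P' => //; exists (len p).+1 => //=; right; split=> //.
exists (sh B p); last by rewrite inE.
by exists p.
Qed.

Theorem theorem2p3 (A : set permutation) (N n m : nat)
    (n_gt0 : 0 < n) (le_nN : n <= N) (m_gt0 : 0 < m) :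
  upto n A `<=` upto n (Av (BiSC (upto N A) m))
  /\ forall (L : seq mesh_pattern) (k : nat),
       A = Av [set P | P \in L] ->
       k = \max_(P <- L) mesh_len P ->
       k <= n -> k <= m ->
       upto n A = upto n (Av (BiSC (upto N A) m)).
Proof.
have sub : upto n A `<=` upto n (Av (BiSC (upto N A) m)).
  move=> pi [Api lepi]; split=> // P /BiSC_not_contained; apply.
  by split=> //; apply: leq_trans le_nN.
split=> // L k defA defk _ lekm; apply/seteqP; split=> // pi [avpi lepi].
split=> //; rewrite defA => P LP piP.
have lePm : mesh_len P <= m.
  by apply: leq_trans lekm; rewrite defk; apply: leq_bigmax_seq.
(* All of [upto N A] avoids the basis element [P], so [P] entails an output pattern [Q], which [pi]
   would then contain. *)
have [|Q /avpi nQ /(_ pi piP) //] := @BiSC_entailed (upto N A) m P lePm.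
by move=> s []; rewrite defA => /(_ P LP).
Qed.
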